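(* Let $K$ be a scattered compact Hausdorff space of weight $\omega_1$. Then $C_p(K)$ is SLD (with respect to the uniform metric) if and only if for every $\varepsilon>0$ there exists a countable family $\{X_n:n\in\omega\}$ of subspaces of $C_p(K)$ that covers $C_p(K,\{0,1\})$ (that is, $C_p(K,\{0,1\})\subset\bigcup_{n\in\omega}X_n$) such that for each $n\in\omega$ the space $X_n$ has an $\varepsilon$-open partitioning of length $\omega_1$ (with respect to the uniform metric).
   Context: $C_p(K)$ is the set of all continuous functions $K\to\mathbb{R}$ with the topology of pointwise convergence (inherited from $\mathbb{R}^K$); $C_p(K,\{0,1\})$ is its subspace of functions with values in $\{0,1\}$. The uniform metric is $\rho(f,g)=\sup_{x\in K}|f(x)-g(x)|$. A space is scattered if every nonempty subspace has an isolated point. A topological space $(X,\tau)$ has property SLD with respect to a metric $\rho$ on $X$ if for every $\varepsilon>0$ there is a countable cover $\{X_n:n\in\omega\}$ of $X$ such that each $X_n$ (with the subspace topology) admits a cover by relatively $\tau$-open sets each having $\rho$-diameter $<\varepsilon$. Let $X$ be a space with a metric $\rho$ (not necessarily inducing its topology). An $\varepsilon$-open partitioning of length $\alpha$ of $X$ is an increasing (i.e. $U_\beta\subset U_\gamma$ for $\beta\le\gamma$) family $\{U_\beta:\beta<\alpha\}$ of nonempty open subsets of $X$ that covers $X$ and satisfies $\mathrm{diam}_\rho\bigl(U_\gamma\setminus\bigcup_{\beta<\gamma}U_\beta\bigr)<\varepsilon$ for every $\gamma<\alpha$. For subspaces $X_n\subset C_p(K)$, open sets are taken in the relative pointwise topology.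 *)

(* Defs.v *)
From HB Require Import structures.
From mathcomp Require Import all_boot all_order all_algebra.
From mathcomp Require Import all_classical all_reals all_analysis.
From mathcomp Require wochoice.
Import Order.TTheory GRing.Theory Num.Theory.
Import numFieldNormedType.Exports.

Set Implicit Arguments.
Unset Strict Implicit.
Unset Printing Implicit Defensive.

Local Open Scope classical_set_scope.
Local Open Scope card_scope.
Local Open Scope ring_scope.

(* The first uncountable ordinal: fix a well-order of the uncountable type
   [set nat] and keep the points with countably many predecessors. The lemmas
   [omega1_well_order], [omega1_uncountable] and [countable_le_omega1]
   characterize the resulting order type. *)
Definition wo_setnat : rel (set nat) :=
  sval (wochoice.well_ordering_principle (set nat)).

Definition omega1_set : set (set nat) :=
  [set x | countable [set y | wo_setnat y x]].

Definition omega1 : Type := set_type omega1_set.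

HB.instance Definition _ := Choice.copy omega1 (set_type omega1_set).

Definition omega1_le : rel omega1 :=
  fun x y => wo_setnat (set_val x) (set_val y).

Fact wo_setnat_wo : wochoice.well_order wo_setnat.
Proof. by rewrite /wo_setnat; case: wochoice.well_ordering_principle. Qed.

Fact wo_setnat_chain : wochoice.wo_chain wo_setnat predT.
Proof. by move=> A _; exact: wo_setnat_wo. Qed.

Fact wo_setnat_refl : reflexive wo_setnat.
Proof. by move=> x; exact: (wochoice.wo_chain_reflexive wo_setnat_chain). Qed.

Fact wo_setnat_anti : antisymmetric wo_setnat.
Proof.
by move=> x y; apply: (wochoice.wo_chain_antisymmetric wo_setnat_chain).
Qed.

Fact wo_setnat_total : total wo_setnat.
Proof. by move=> x y; exact: (wochoice.wo_chainW wo_setnat_chain). Qed.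

Fact wo_setnat_trans : transitive wo_setnat.
Proof.
move=> y x z xy yz.
have [|m [[mA lbm] _]] := wo_setnat_wo (A := [pred t | t \in [:: x; y; z]]).
  by exists x; rewrite !inE eqxx.
have [mx my mz] : [/\ wo_setnat m x, wo_setnat m y & wo_setnat m z].
  by split; apply: lbm; rewrite !inE eqxx ?orbT.
move: mA; rewrite !inE => /or3P[] /eqP em; subst m.
- exact: mz.
- by have -> : x = y by apply: wo_setnat_anti; rewrite xy mx.
- by have -> : z = y by apply: wo_setnat_anti; rewrite my yz.
Qed.

Fact omega1_le_refl : reflexive omega1_le.
Proof. by move=> x; exact: wo_setnat_refl. Qed.

Fact omega1_le_anti : antisymmetric omega1_le.
Proof. by move=> x y /wo_setnat_anti; exact: val_inj. Qed.

Fact omega1_le_trans : transitive omega1_le.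
Proof. by move=> y x z; exact: wo_setnat_trans. Qed.

Fact omega1_le_total : total omega1_le.
Proof. by move=> x y; exact: wo_setnat_total. Qed.

Fact omega1_display : Order.disp_t. Proof. exact: Order.Disp tt tt. Qed.

HB.instance Definition _ := Order.Le_isPOrder.Build omega1_display omega1
  omega1_le_refl omega1_le_anti omega1_le_trans.
HB.instance Definition _ :=
  Order.POrder_isTotal.Build omega1_display omega1 omega1_le_total.

Lemma omega1_well_order : wochoice.well_order (<=%O : rel omega1).
Proof.
apply: wochoice.antisymmetric_well_order; first exact: omega1_le_anti.
move=> A [a Aa].
pose B : {pred set nat} := [pred x | `[< exists2 w, w \in A & set_val w = x >]].
have [|m [[]]] := wo_setnat_wo (A := B).
  by exists (set_val a); apply/asboolP; exists a.
move=> /asboolP[w Aw <-] lbw _; exists w; split=> // v Av.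
by apply: lbw; apply/asboolP; exists v.
Qed.

Lemma countable_le_omega1 (w : omega1) :
  countable [set v : omega1 | (v <= w)%O].
Proof.
have [f finj] : exists f : set nat -> nat,
    {in [set y | wo_setnat y (set_val w)] &, injective f}.
  by apply/countable_injP; exact: (set_valP w).
apply/countable_injP; exists (f \o set_val) => u v.
rewrite !inE => uw vw fuv; apply: val_inj.
by apply: finj => //; rewrite inE.
Qed.

Fact uncountable_setnat : ~ countable [set: set nat].
Proof.
move=> /countable_injP[f finj].
pose D : set nat := [set n | exists2 A, f A = n & ~ A n].
have [DD|nDD] := pselect (D (f D)).
  have [A fA nA] := DD.
  have AD : A = D by exact: finj (mem_set I) (mem_set I) fA.
  by apply: nA; rewrite [X in X (f D)]AD.
by apply: (nDD); exists D.
Qed.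

Lemma omega1_uncountable : ~ countable [set: omega1].
Proof.
move=> /countable_injP[f finj].
have cS : countable omega1_set.
  have -> : omega1_set = range (set_val : omega1 -> set nat).
    apply/seteqP; split=> [x Sx|_ [w _ <-]]; last exact: set_valP.
    by exists (exist _ x (mem_set Sx)).
  by apply: card_le_trans (card_image_le _ _) _; apply/countable_injP; exists f.
have [[x nSx]|allS] := pselect (exists x, ~ omega1_set x); last first.
  apply: uncountable_setnat; apply: sub_countable cS; apply: subset_card_le.
  by move=> x _; apply: contrapT => nSx; apply: allS; exists x.
have [|m [[mA lbm] _]] := wo_setnat_wo (A := [pred y | y \notin omega1_set]).
  by exists x; rewrite !inE; apply/negP; rewrite inE.
move: mA; rewrite !inE => /negP; rewrite inE; apply.
apply: (@sub_countable _ _ _ (omega1_set `|` [set m])); last first.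
  have /countable_injP[g ginj] := cS.
  apply/countable_injP; exists (fun y => if y == m then 0%N else (g y).+1).
  move=> y z; rewrite !inE /= => Sy Sz.
  case: eqP => [-> | ym]; case: eqP => [-> // | zm] // [gyz].
  by apply: ginj gyz; rewrite inE; [case: Sy | case: Sz].
apply: subset_card_le => y /= ym; have [Sy|nSy] := pselect (omega1_set y).
  by left.
right; apply: wo_setnat_anti; rewrite ym lbm // !inE.
by apply/negP; rewrite inE.
Qed.

Section Spaces.
Variable R : realType.

Definition scattered (X : topologicalType) : Prop :=
  forall A : set X, A !=set0 -> isolated A !=set0.

(* [has_weight X A]: the least cardinality of a basis of [X] is that of [A]. *)
Definition has_weight (X : topologicalType) (I : Type) (A : set I) : Prop :=
  (exists2 B : set (set X), basis B & B #= A) /\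
  (forall B : set (set X), basis B -> A #<= B).

(* The diameter of the empty set is [-oo]; this is harmless, diameters being
   only compared with positive numbers. *)
Definition diam (X : Type) (rho : X -> X -> R) (A : set X) : \bar R :=
  ereal_sup [set (rho x y)%:E | x in A & y in A].

Definition sub_metric (X : Type) (rho : X -> X -> R) (A : set X) :
    set_type A -> set_type A -> R :=
  fun x y => rho (set_val x) (set_val y).

(* As in the definition below, subsets [A] of a space are made into spaces by
   the topology that [set_type A] carries in the library. *)
Definition SLD (X : topologicalType) (rho : X -> X -> R) : Prop :=
  forall e : R, 0 < e ->
  exists Xs : nat -> set X,
    \bigcup_n Xs n = [set: X] /\
    forall n, exists C : set (set (set_type (Xs n))),
      [/\ C `<=` open,
          \bigcup_(V in C) V = [set: set_type (Xs n)] &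
          forall V, C V -> (diam (sub_metric rho (A := Xs n)) V < e%:E)%E].

(* [W] stands for the ordinal length; it is meant to be well-ordered. *)
Definition has_open_partitioning (d : Order.disp_t) (W : orderType d)
    (X : topologicalType) (rho : X -> X -> R) (e : R) : Prop :=
  exists U : W -> set X,
    [/\ forall b, open (U b) /\ U b !=set0,
        forall b c, (b <= c)%O -> U b `<=` U c,
        \bigcup_b U b = [set: X] &
        forall c,
          (diam rho (U c `\` \bigcup_(b in [set b | (b < c)%O]) U b) < e%:E)%E].

Variable K : topologicalType.

Definition Cp : Type :=
  initial_topology (fun f : continuousType K R => (f : {ptws K -> R})).

HB.instance Definition _ := Topological.copy Cp
  (initial_topology (fun f : continuousType K R => (f : {ptws K -> R}))).

Definition Cp_fun (f : Cp) : K -> R := (f : continuousType K R).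

Definition Cp01 : set Cp :=
  [set f | forall x, Cp_fun f x = 0 \/ Cp_fun f x = 1].

(* Genuine supremum when [K] is compact and nonempty. *)
Definition uniform_metric (f g : Cp) : R :=
  sup [set `|Cp_fun f x - Cp_fun g x| | x in [set: K]].

End Spaces.

(* Main.v *)
Require Import Defs.
From HB Require Import structures.
From mathcomp Require Import all_boot all_order all_algebra.
From mathcomp Require Import all_classical all_reals all_analysis.
From mathcomp Require Import lra.
Import Order.TTheory GRing.Theory Num.Theory.
Import numFieldNormedType.Exports.
Local Open Scope classical_set_scope.
Local Open Scope ring_scope.

(* The implication from left to right holds because the pointwise topology has
   a network of omega1 sets, the basic ones being given by finitely many
   conditions of the form "f maps b_i into a rational interval" with b_i basic
   open, and only countably many of them involve indices i below a given one.
   A cover by small open sets is thus exhausted in omega1 stages, and a countable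
   decomposition leaves a single small set in the layer of each stage.

   For the converse, identify {0,1}-valued functions with clopen sets. Distinct
   ones are at distance 1, so a 1-open partitioning of length omega1 of X_n says
   that the X_n-part of the algebra of clopen sets is right-separated with
   countable initial segments, hence pointwise locally countable. A subalgebra
   of clopen sets is pointwise closed, by compactness. Write the clopen algebra
   as an increasing omega1-union of countable subalgebras that also contain,
   with each S in X_n, a countable X_n-neighbourhood of S. If a is the first
   stage containing S, then S has a neighbourhood in X_n that meets only the
   countable set of clopen sets first appearing at stage a; enumerating each
   such layer makes the clopen algebra a countable union of discrete subspaces.
   Finally, K being scattered, f(K) is nowhere dense, so f is determined up to
   e/2 by finitely many clopen sets {f < c} with c rational and c not in f(K);
   these depend continuously on f once the numbers c are fixed. *)


(** * Countability, diameters and pointwise neighbourhoods *)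

Lemma omega1_min (P : set omega1) : P !=set0 ->
  exists2 m, P m & forall x, P x -> (m <= x)%O.
Proof.
move=> [x Px].
have [|m [[mP lbm] _]] := omega1_well_order (A := [pred y | y \in P]).
  by exists x; rewrite !inE.
exists m; first by move: mP; rewrite !inE.
by move=> y Py; apply: lbm; rewrite !inE.
Qed.

Lemma omega1_nonempty : [set: omega1] !=set0.
Proof.
by apply/set0P/eqP => e0; apply: omega1_uncountable; rewrite e0.
Qed.

Lemma countable_seq (T : eqType) (A : set T) : countable A ->
  countable [set s : seq T | forall x, x \in s -> A x].
Proof.
move=> /countable_injP[h hinj]; apply/countable_injP.
exists (pickle \o map h) => s t; rewrite !inE /= => As At.
move=> /(pcan_inj pickleK).
elim: s t As At => [|x s IH] [|y t] //= As At [hxy /IH <-].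
- congr (_ :: _); apply: hinj => //.
  + by rewrite inE; apply: As; rewrite mem_head.
  + by rewrite inE; apply: At; rewrite mem_head.
- by move=> z zs; apply: As; rewrite inE zs orbT.
- by move=> z zs; apply: At; rewrite inE zs orbT.
Qed.

Lemma diamS (R : realType) (X : Type) (rho : X -> X -> R) (A B : set X) :
  A `<=` B -> (diam rho A <= diam rho B)%E.
Proof.
move=> AB; apply: ereal_sup_le => _ [x Ax] [y Ay] <-.
by exists x; [exact: AB|exists y; [exact: AB|]].
Qed.

Lemma diam_set0 (R : realType) (X : Type) (rho : X -> X -> R) :
  diam rho set0 = -oo%E.
Proof.
rewrite /diam (_ : [set _ | _ in _ & _ in _] = set0) ?ereal_sup0//.
by apply/seteqP; split=> // ? [].
Qed.

Lemma diam_sub_metric (R : realType) (X : Type) (rho : X -> X -> R)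
    (A B : set X) :
  diam (sub_metric rho (A := A)) (set_val @^-1` B) = diam rho (A `&` B).
Proof.
rewrite /diam; congr ereal_sup; apply/seteqP; split.
  move=> _ [x Bx] [y By] <-; exists (set_val x); first by split=> //; exact: set_valP.
  by exists (set_val y) => //; split=> //; exact: set_valP.
move=> _ [x [Ax Bx]] [y [Ay By]] <-.
by exists (exist _ x (mem_set Ax)) => //; exists (exist _ y (mem_set Ay)).
Qed.

(** The sets [B p] generate a filter converging pointwise to [Cp_fun f], so every open set of the
    product around [Cp_fun f] includes one of them. *)
Lemma Cp_open_nbhs (R : realType) (K : topologicalType) (f : Cp R K)
    (W : set (Cp R K)) : open W -> W f ->
  exists s : seq K, exists2 d : R, 0 < d & forall g : Cp R K,
    (forall x, x \in s -> `|Cp_fun f x - Cp_fun g x| < d) -> W g.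
Proof.
move=> [A oA <-] Af.
pose D : set (seq K * R) := [set p | 0 < p.2].
pose B (p : seq K * R) := [set g : K -> R | forall x, x \in p.1 -> `|Cp_fun f x - g x| < p.2].
have FF : Filter (filter_from D B).
  apply: filter_from_filter; first by exists ([::], 1); rewrite /D /=.
  move=> [s d] [t e]; rewrite /D /= => d0 e0.
  exists (s ++ t, Num.min d e); first by rewrite /= lt_min d0.
  move=> g /= gst; split=> x xs; have /= := gst x; rewrite mem_cat xs ?orbT => /(_ isT);
    by rewrite lt_min => /andP[].
have cF : {ptws, filter_from D B --> Cp_fun f}.
  apply/(@pointwise_cvgP _ _ _ _ FF) => x U /nbhs_ballP[e /= e0 eU].
  exists ([:: x], e) => //= g /(_ x); rewrite inE eqxx => /(_ isT) /= gx.
  exact: eU.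
have [[s d] /= d0 sA] : filter_from D B A by apply: cF; exact: open_nbhs_nbhs.
by exists s, d => // g gs; apply: sA.
Qed.

Lemma Cp_eval_open (R : realType) (K : topologicalType) (x : K) (U : set R) :
  open U -> open [set f : Cp R K | U (Cp_fun f x)].
Proof.
move=> oU; exists (proj x @^-1` U) => //.
by apply: open_comp oU => g _; exact: proj_continuous.
Qed.


(** * From SLD to open partitionings *)

(* [a0] is the first stage at which the cover meets [Y]; starting from it keeps
   every member of the partitioning nonempty without enlarging any layer. *)
Lemma open_partitioning_of_ranked_cover (R : realType) (T : topologicalType)
    (rho : T -> T -> R) (e : R) (X Y : set T) (I : Type) (r : I -> omega1)
    (W : I -> set T) (c : T -> I) :
  0 < e -> (forall i, open (W i)) ->
  (forall i, (diam rho (X `&` W i) < e%:E)%E) ->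
  Y `<=` X -> Y !=set0 ->
  (forall f, Y f -> W (c f) f /\ forall j, W j f -> (r (c f) <= r j)%O) ->
  (forall f g, Y f -> Y g -> r (c f) = r (c g) -> c f = c g) ->
  has_open_partitioning omega1 (sub_metric rho (A := Y)) e.
Proof.
move=> e0 oW dW YX [f0 Yf0] cmin cinj.
pose G a := \bigcup_(i in [set i | (r i <= a)%O]) W i.
have oG a : open (G a) by apply: bigcup_open.
have GS a b : (a <= b)%O -> G a `<=` G b.
  by move=> ab f [i /= ia Wf]; exists i => //=; exact: le_trans ab.
have [a0 [g0 Yg0 Gg0] a0min] : exists2 a, exists2 f, Y f & G a f &
    forall b, (exists2 f, Y f & G b f) -> (a <= b)%O.
  apply: omega1_min; have [Wc _] := cmin _ Yf0.
  by exists (r (c f0)), f0 => //; exists (c f0) => /=.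
exists (fun b => set_val @^-1` (G (Order.max b a0))); split.
- move=> b; split; first by exists (G (Order.max b a0)).
  by exists (exist _ g0 (mem_set Yg0)) => /=; apply: GS Gg0; rewrite le_max lexx orbT.
- by move=> b b' bb f; apply: GS; rewrite ge_max !le_max bb lexx orbT.
- apply/seteqP; split=> // f _; have [Wc _] := cmin _ (set_valP f).
  by exists (r (c (set_val f))) => //; exists (c (set_val f)) => //=; rewrite le_max lexx.
move=> a.
pose H := G (Order.max a a0) `\` \bigcup_(b in [set b | (b < a)%O]) G (Order.max b a0).
rewrite (_ : _ `\` _ = set_val @^-1` H); last first.
  by apply/seteqP; split=> f /= [Gf nf]; split=> // -[b ba Gb]; apply: nf; exists b.
rewrite diam_sub_metric.
have [YH0|/set0P[f [Yf Hf]]] := eqVneq (Y `&` H) set0.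
  by rewrite YH0 diam_set0 ltNyr.
(* Ranks on [Y] are at least [a0], so a rank below [Order.max a a0] would be below [a] and would put
   the point into an earlier member. *)
have rk g : Y g -> H g -> r (c g) = Order.max a a0.
  move=> Yg [[j /= ja Wj] nG]; have [Wc mc] := cmin _ Yg.
  apply/eqP; rewrite eq_le; apply/andP; split; first exact: le_trans (mc _ Wj) ja.
  have ac : (a0 <= r (c g))%O by apply: a0min; exists g => //; exists (c g) => /=.
  rewrite leNgt; apply/negP => ltc; apply: nG; exists (r (c g)).
    by move: ltc; rewrite lt_max [X in _ || X]ltNge ac orbF.
  by exists (c g) => //=; rewrite le_max lexx.
apply: le_lt_trans (dW (c f)); apply: diamS => g [Yg Hg]; split; first exact: YX.
by rewrite (cinj f g) ?rk//; have [] := cmin _ Yg.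
Qed.

(* [X_n] is split according to the number, within its countable rank class, of a
   network element of least rank witnessing smallness at the point: on each
   piece the rank alone determines that element. *)
Lemma SLD_open_partitionings (R : realType) (T : topologicalType)
    (rho : T -> T -> R) (t0 : T) (I : choiceType) (N : I -> set T)
    (r : I -> omega1) :
  rho t0 t0 <= 0 ->
  (forall a, countable [set i | r i = a]) ->
  (forall f W, open W -> W f -> exists2 i, N i f & N i `<=` W) ->
  SLD rho -> forall e : R, 0 < e -> exists Xs : nat -> set T,
    \bigcup_n Xs n = setT /\
    forall n, has_open_partitioning omega1 (sub_metric rho (A := Xs n)) e.
Proof.
move=> t00 rc netN sld e e0.
have [Xs [Xcov Xsmall]] := sld e e0.
have {}Xsmall n f : Xs n f -> exists W,
    [/\ open W, W f & (diam rho (Xs n `&` W) < e%:E)%E].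
  move=> Xf; have [C [Co Ccov Cd]] := Xsmall n.
  have : (\bigcup_(V in C) V) (exist _ f (mem_set Xf)) by rewrite Ccov.
  move=> [V CV Vf]; have [W oW WV] := Co _ CV.
  exists W; split=> //; first by move: Vf; rewrite -WV.
  by have := Cd _ CV; rewrite -WV diam_sub_metric.
pose ok n i W := [/\ open W, (diam rho (Xs n `&` W) < e%:E)%E & Xs n `&` N i `<=` W].
(* One small open set is fixed for each pair, including the trace of [N i] on [Xs n] whenever that
   is possible; otherwise [set0] meets the other two conditions. *)
have /choice[W WP] : forall p : nat * I, exists V, [/\ open V,
    (diam rho (Xs p.1 `&` V) < e%:E)%E &
    (exists V', ok p.1 p.2 V') -> Xs p.1 `&` N p.2 `<=` V].
  move=> [n i] /=; have [[V [oV dV NV]]|nV] := pselect (exists V, ok n i V).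
    by exists V.
  by exists set0; split=> //; [exact: open0|rewrite setI0 diam_set0 ltNyr].
have /choice[h hinj] : forall a, exists g : I -> nat,
    {in [set i | r i = a] &, injective g}.
  by move=> a; exact/countable_injP.
pose least n f i := W (n, i) f /\ forall j, W (n, j) f -> (r i <= r j)%O.
have lex n f : Xs n f -> exists i, least n f i.
  move=> Xf; have [V [oV Vf dV]] := Xsmall _ _ Xf.
  have [i Ni NV] := netN _ _ oV Vf.
  have [_ _ /= NW] := WP (n, i).
  have Wi : W (n, i) f by apply: NW => //; exists V; split=> // g [_ /NV].
  have [a [j Wj <-] ja] : exists2 a, exists2 j, W (n, j) f & r j = a &
      forall b, (exists2 j, W (n, j) f & r j = b) -> (a <= b)%O.
    by apply: omega1_min; exists (r i), i.
  by exists j; split=> // k Wk; apply: ja; exists k.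
have /choice[c cP] : forall p : nat * T, exists i, Xs p.1 p.2 -> least p.1 p.2 i.
  move=> [n f] /=.
  have [Xf|nX] := pselect (Xs n f); first by have [i] := lex _ _ Xf; exists i.
  have [n' _ Xf] : (\bigcup_n Xs n) f by rewrite Xcov.
  by have [i _] := lex _ _ Xf; exists i.
pose Y n m := [set f | Xs n f /\ h (r (c (n, f))) (c (n, f)) = m].
(* Members of a partitioning are nonempty, so empty pieces and idle codes are replaced by the
   singleton of [t0]. *)
pose Z k := if unpickle k is Some p then
  (if `[< Y p.1 p.2 !=set0 >] then Y p.1 p.2 else [set t0]) else [set t0].
exists Z; split.
  apply/seteqP; split=> // f _.
  have [n _ Xf] : (\bigcup_n Xs n) f by rewrite Xcov.
  set i := c (n, f); have Yf : Y n (h (r i) i) f by [].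
  exists (pickle (n, h (r i) i)) => //; rewrite /Z pickleK /=.
  by case: asboolP => //; case; exists f.
have point : has_open_partitioning omega1 (sub_metric rho (A := [set t0])) e.
  exists (fun=> setT); split=> //.
  - move=> b; split; first exact: openT.
    by exists (exist _ t0 (mem_set (erefl t0))).
  - have [//|i _ _] := netN t0 setT openT.
    by apply/seteqP; split=> // f _; exists (r i).
  - move=> c'; apply: (@le_lt_trans _ _ 0%E); last by rewrite lte_fin.
    apply: ge_ereal_sup => _ [x _] [y _] <-; rewrite /sub_metric.
    have /= -> : set_val x = t0 := set_valP x.
    by have /= -> : set_val y = t0 := set_valP y; rewrite lee_fin.

move=> k; rewrite /Z; case: unpickle => [[n m]|] //=; case: asboolP => // Y0.
apply: (@open_partitioning_of_ranked_cover _ _ _ _ (Xs n) _ I r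
  (fun i => W (n, i)) (fun f => c (n, f))) => //.
- by move=> i; have [] := WP (n, i).
- by move=> i; have [] := WP (n, i).
- by move=> f [].
- by move=> f [Xf _]; exact: cP (n, f) Xf.
move=> f g [_ hf] [_ hg] rfg; apply: (hinj (r (c (n, f)))).
- by rewrite inE.
- by rewrite inE /= rfg.
- by rewrite hf {1}rfg hg.
Qed.


(** * Algebras of sets generated in countable stages *)

(** [agree s A] is the basic neighbourhood of [A] given by [s] in the topology of pointwise
    convergence on sets. *)
Definition agree {T : eqType} (s : seq T) (A B : set T) : Prop :=
  forall x, x \in s -> A x <-> B x.

(* [N n S] stands for a prescribed neighbourhood of [S] in the [n]-th piece. *)
Definition gen_step {T : Type} (N : nat -> set T -> set (set T))
    (B : set (set T)) : set (set T) :=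
  B `|` [set ~` S | S in B] `|` [set S `&` S' | S in B & S' in B] `|`
  \bigcup_n \bigcup_(S in B) N n S.

(** The closure of [B] under complements, binary intersections and passage to the members of
    [N n S]. These operations are finitary, so omega rounds reach it. *)
Definition gen {T : Type} (N : nat -> set T -> set (set T))
    (B : set (set T)) : set (set T) :=
  \bigcup_k iter k (gen_step N) B.

Section Generated.
Context {T : Type} (N : nat -> set T -> set (set T)).
Implicit Types B : set (set T).

Lemma gen_stepS B B' : B `<=` B' -> gen_step N B `<=` gen_step N B'.
Proof.
move=> BB'; apply: setUSS; first apply: setUSS; first apply: setUSS => //.
- exact: image_subset.
- by move=> _ [S BS] [S' BS'] <-; exists S; [exact: BB'|exists S' => //; exact: BB'].
- by move=> S [n _ [S' BS' NS]]; exists n => //; exists S' => //; exact: BB'.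
Qed.

Lemma gen_step_ext B : B `<=` gen_step N B.
Proof. by move=> S BS; left; left; left. Qed.

Lemma gen_ext B : B `<=` gen N B.
Proof. by move=> S BS; exists 0%N. Qed.

Lemma gen_monotone B B' : B `<=` B' -> gen N B `<=` gen N B'.
Proof.
move=> BB' S [k _ kS]; exists k => //; elim: k S kS => [|k IH] //=.
exact: gen_stepS.
Qed.

Lemma iter_gen_stepS B k l : (k <= l)%N ->
  iter k (gen_step N) B `<=` iter l (gen_step N) B.
Proof.
move=> /subnK <-; elim: (l - k)%N => [|m IH] //=.
exact: subset_trans IH (@gen_step_ext _).
Qed.

Lemma genC B S : gen N B S -> gen N B (~` S).
Proof. by move=> [k _ kS]; exists k.+1 => //=; left; left; right; exists S. Qed.

Lemma genI B S S' : gen N B S -> gen N B S' -> gen N B (S `&` S').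
Proof.
move=> [k _ kS] [l _ lS']; exists (maxn k l).+1 => //=; left; right.
exists S; first exact: iter_gen_stepS (leq_maxl _ _) _ kS.
by exists S' => //; exact: iter_gen_stepS (leq_maxr _ _) _ lS'.
Qed.

Lemma gen_nbhs B n S : gen N B S -> N n S `<=` gen N B.
Proof.
by move=> [k _ kS] S' NS'; exists k.+1 => //=; right; exists n => //; exists S.
Qed.

Lemma gen_min B P : B `<=` P -> (forall S, P S -> P (~` S)) ->
  (forall S S', P S -> P S' -> P (S `&` S')) ->
  (forall n S, P S -> N n S `<=` P) -> gen N B `<=` P.
Proof.
move=> BP PC PI PN S [k _ kS]; elim: k S kS => [|k IH] S /=; first exact: BP.
case=> [[[/IH//|[S' /IH PS' <-]]|[S1 /IH P1 [S2 /IH P2 <-]]]|[n _ [S' /IH PS' NS]]].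
- exact: PC.
- exact: PI.
- exact: PN NS.
Qed.

Lemma gen_countable B : (forall n S, countable (N n S)) ->
  countable B -> countable (gen N B).
Proof.
move=> Nc Bc; apply: bigcup_countable => // k _; elim: k => //= k IH.
have cU (A A' : set (set T)) : countable A -> countable A' -> countable (A `|` A').
  by move=> cA cA'; rewrite -bigcup2E; apply: bigcup_countable => // -[|[|n]] _ //=; exact: countable0.
apply: (cU _ _); last by apply: bigcup_countable => // n _; apply: bigcup_countable.
apply: (cU _ _); first apply: (cU _ _) => //.
  by apply: sub_countable IH; exact: card_image_le.
have := countableX IH IH; apply: sub_countable.
apply: card_le_trans (card_image_le (fun p => p.1 `&` p.2) _).
by apply: subset_card_le => _ [S BS] [S' BS'] <-; exists (S, S').
Qed.

End Generated.

(** A set [S] is filed under its piece [n] and its number in the first countable stage [G (a S)]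
    containing it. For [S'] in the same class, agreement on [w n S] gives [a S' <= a S], a
    neighbourhood missing all earlier stages gives equality, and the common number gives
    [S' = S]. *)
Lemma locally_countable_sigma_discrete (T : eqType) (CO : set (set T))
    (A0 : omega1 -> set (set T)) (X : nat -> set (set T))
    (w : nat -> set T -> seq T) :
  (forall S, CO S -> CO (~` S)) ->
  (forall S S', CO S -> CO S' -> CO (S `&` S')) ->
  (forall B : set (set T), B `<=` CO -> (forall S, B S -> B (~` S)) ->
    (forall S S', B S -> B S' -> B (S `&` S')) ->
    forall S, CO S -> ~ B S -> exists s, forall S', B S' -> ~ agree s S S') ->
  (forall a, countable (A0 a)) ->
  (forall a b, (a <= b)%O -> A0 a `<=` A0 b) ->
  CO = \bigcup_a A0 a ->
  CO = \bigcup_n X n ->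
  (forall n S, X n S -> countable [set S' | X n S' /\ agree (w n S) S S']) ->
  exists D : nat * nat -> set (set T),
    CO = \bigcup_p D p /\
    forall p S, D p S -> exists s, forall S', D p S' -> agree s S S' -> S' = S.
Proof.
move=> COC COI COclosed A0c A0S COA0 COX Xc.
(* The clause [X n S] makes [N n S] empty off the piece, where no countable neighbourhood is
   given. *)
pose N n S := [set S' | X n S /\ X n S' /\ agree (w n S) S S'].
have Nc n S : countable (N n S).
  have [XS|nXS] := pselect (X n S).
    by apply: sub_countable (Xc _ _ XS); apply: subset_card_le => S' [].
  rewrite (_ : N n S = set0) ?countable0//.
  by apply/seteqP; split=> // S' [].
pose G a := gen N (A0 a).
have Gc a : countable (G a) by exact: gen_countable.
have GS a b : (a <= b)%O -> G a `<=` G b by move=> /A0S/gen_monotone; exact.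
have GCO a : G a `<=` CO.
  apply: gen_min => //; first by rewrite COA0 => S; exists a.
  by move=> n S _ S' [_ [XS' _]]; rewrite COX; exists n.
have lev S : exists a, CO S -> G a S /\ forall b, G b S -> (a <= b)%O.
  have [COS|nCO] := pselect (CO S).
    have [a Ga amin] : exists2 a, G a S & forall b, G b S -> (a <= b)%O.
      apply: omega1_min; move: COS; rewrite COA0 => -[a _ Aa].
      by exists a; exact: gen_ext.
    by exists a.
  by have [a _] := omega1_nonempty; exists a.
have /choice[a aP] := lev.
have /choice[h hinj] : forall b, exists g : set T -> nat, {in G b &, injective g}.
  by move=> b; exact/countable_injP.
exists (fun p => [set S | X p.1 S /\ h (a S) S = p.2]); split.
  rewrite COX; apply/seteqP; split=> S.
    by move=> [n _ XS]; exists (n, h (a S) S).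
  by move=> [[n m] _ [XS _]]; exists n.
move=> [n m] S /= [XS hS].
have XCO S' : X n S' -> CO S' by move=> XS'; rewrite COX; exists n.
have [GaS amin] := aP _ (XCO _ XS).
(* The union of the earlier stages is a subalgebra, hence closed. *)
pose B := \bigcup_(b in [set b | (b < a S)%O]) G b.
have [s sP] : exists s, forall S', B S' -> ~ agree s S S'.
  apply: COclosed.
  - by move=> S' [b _ /GCO].
  - by move=> S' [b ba Gb]; exists b => //; exact: genC.
  - move=> S1 S2 [b1 /= b1a Gb1] [b2 /= b2a Gb2].
    exists (Order.max b1 b2); first by rewrite /= gt_max b1a.
    by apply: genI; [apply: GS Gb1|apply: GS Gb2]; rewrite le_max lexx ?orbT.
  - exact: XCO.
  - by move=> [b /= ba /amin]; rewrite leNgt ba.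
exists (w n S ++ s) => S' [XS' hS'] agr.
have [GaS' amin'] := aP _ (XCO _ XS').
have le1 : (a S' <= a S)%O.
  apply: amin'; apply: (gen_nbhs _ _ n S GaS); split=> //; split=> // x xw.
  by apply: agr; rewrite mem_cat xw.
have e : a S' = a S.
  apply/eqP; rewrite eq_le le1 leNgt /=; apply/negP => lt1.
  apply: (sP S'); first by exists (a S').
  by move=> x xs; apply: agr; rewrite mem_cat xs orbT.
apply: (hinj (a S)); rewrite ?inE //; first by rewrite -e.
by rewrite hS -hS' e.
Qed.

Lemma open_bigcap_seq (T : topologicalType) (J : eqType) (s : seq J)
    (P : J -> set T) :
  (forall i, i \in s -> open (P i)) ->
  open [set x | forall i, i \in s -> P i x].
Proof.
elim: s => [|i s IH] oP.
  have -> : [set x | forall i, i \in [::] -> P i x] = setT by apply/seteqP; split.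
  exact: openT.
rewrite (_ : [set _ | _] = P i `&` [set x | forall j, j \in s -> P j x]).
  apply: openI; first by apply: oP; rewrite mem_head.
  by apply: IH => j js; apply: oP; rewrite inE js orbT.
apply/seteqP; split=> x /= Px.
  by split; [apply: Px; rewrite mem_head|move=> j js; apply: Px; rewrite inE js orbT].
by move=> j; rewrite inE => /predU1P[->|]; [exact: Px.1|exact: Px.2].
Qed.


(** * Compactness, scatteredness and nowhere dense images *)

(** This stands in for finite subcovers below, with [P] asserting a nowhere dense image or the
    existence of a finite list or of a member of an algebra. *)
Lemma compact_ind (T : topologicalType) (C : set T) (P : set T -> Prop) :
  compact C -> P set0 -> (forall A B, P A -> P B -> P (A `|` B)) ->
  (forall A B, A `<=` B -> P B -> P A) ->
  (forall x, C x -> exists V, [/\ open V, V x & P V]) -> P C.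
Proof.
move=> cC P0 PU PS loc.
apply: contrapT => nPC.
(* If [P] fails for [C], the complements of the sets satisfying [P] generate a
   proper filter without cluster point in [C]. *)
pose F : set_system T := [set A | P (C `&` ~` A)].
have FF : ProperFilter F.
  split; first by rewrite /F /= setC0 setIT.
  split; [by rewrite /F /= setCT setI0| |].
    by move=> A B PA PB; rewrite /F /mkset setCI setIUr; exact: PU.
  by move=> A B AB; apply: PS => x [Cx nBx]; split=> // /AB.
have [|x [Cx Fx]] := cC F FF; first by rewrite /F /= setICr.
have [V [oV Vx PV]] := loc _ Cx.
have [||y [nVy /nVy]//] := Fx (~` V) V; last exact: open_nbhs_nbhs.
by rewrite /F /= setCK; apply: PS PV; exact: subIsetr.
Qed.

Lemma closureI_open (T : topologicalType) (U A : set T) :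
  open U -> U `&` closure A `<=` closure (U `&` A).
Proof.
move=> oU x [Ux Ax] V xV; have [|y [Ay [Vy Uy]]] := Ax (V `&` U).
  by apply: filterI => //; exact: open_nbhs_nbhs.
by exists y.
Qed.

(** An open [U] inside the union of the closures either lies in [closure A] or has the nonempty open
    part outside [closure A] lying in [closure B]. *)
Lemma nowhere_denseU (T : topologicalType) (A B : set T) :
  (closure A)° = set0 -> (closure B)° = set0 -> (closure (A `|` B))° = set0.
Proof.
move=> A0 B0; apply/seteqP; split=> // x; rewrite /interior /= closureU nbhsE.
move=> [U [oU Ux] UAB].
have [UA|/existsNP[y /not_implyP[Uy nAy]]] := pselect (U `<=` closure A).
  suff : (closure A)° x by rewrite A0.
  by rewrite /interior /= nbhsE; exists U.
suff : (closure B)° y by rewrite B0.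
rewrite /interior /= nbhsE; exists (U `&` ~` closure A).
  by split=> //; apply: openI oU _; apply: closed_openC; exact: closed_closure.
by move=> z [/UAB[]].
Qed.

(** Contraposition with two-point lists: some member of [B] then separates any [x] in [S] from any
    [y] outside. Compactness of the complement, with intersections, gives a member between [x] and
    [S]; compactness of [S], with unions, gives [S] itself. *)
Lemma subalgebra_pointwise_closed (T : topologicalType) (B : set (set T)) (S : set T) :
  compact [set: T] -> B `<=` clopen -> (forall S, B S -> B (~` S)) ->
  (forall S S', B S -> B S' -> B (S `&` S')) ->
  clopen S -> ~ B S -> exists s, forall S', B S' -> ~ agree s S S'.
Proof.
move=> cT Bclo BC BI [oS cS] nBS.
have [B0|nB] := pselect (B !=set0); last first.
  by exists [::] => S' BS'; exfalso; apply: nB; exists S'.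
have B00 : B set0.
  by case: B0 => A BA; rewrite -(setICr A); apply: BI => //; exact: BC.
have BU A A' : B A -> B A' -> B (A `|` A').
  by move=> BA BA'; rewrite -(setCK (_ `|` _)) setCU; apply/BC/BI; exact/BC.
apply: contrapT => nsep; apply: nBS.
have sep x y : S x -> ~ S y -> exists2 A, B A & A x /\ ~ A y.
  move=> Sx nSy; apply: contrapT => nA; apply: nsep; exists [:: x; y] => A BA agr.
  apply: nA; exists A => //; split.
    by apply/(agr x); rewrite ?mem_head.
  by move=> /(agr y); rewrite !inE eqxx orbT => /(_ isT).
have sepx x : S x -> exists2 A, B A & A x /\ A `<=` S.
  move=> Sx.
  suff [A BA [Ax AS]] : exists2 A, B A & A x /\ A `&` (~` S) = set0.
    by exists A => //; split=> // z Az; apply: contrapT => nSz; rewrite -[False]/(set0 z) -AS.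
  apply: (@compact_ind _ _ (fun Q => exists2 A, B A & A x /\ A `&` Q = set0)).
  - exact: (subclosed_compact (open_closedC oS) cT (subsetT _)).
  - by exists (~` set0); [exact: BC|split; [case|exact: setI0]].
  - move=> Q Q' [A BA [Ax AQ]] [A' BA' [Ax' AQ']]; exists (A `&` A'); first exact: BI.
    split=> //; rewrite setIUr -setIA [A' `&` Q]setIC setIA AQ set0I set0U.
    by rewrite -setIA AQ' setI0.
  - move=> Q Q' QQ' [A BA [Ax AQ]]; exists A => //; split=> //.
    by apply/seteqP; split=> // z [Az Qz]; rewrite -AQ; split=> //; exact: QQ'.
  move=> y nSy; have [A BA [Ax nAy]] := sep _ _ Sx nSy.
  exists (~` A); split=> //; first by have [_ cA] := Bclo _ BA; exact: closed_openC.
  by exists A => //; rewrite setICr.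
suff [A BA [AS SA]] : exists2 A, B A & A `<=` S /\ S `<=` A.
  by rewrite (_ : S = A)//; apply/seteqP.
apply: (@compact_ind _ _ (fun Q => exists2 A, B A & A `<=` S /\ Q `<=` A)).
- exact: (subclosed_compact cS cT (subsetT _)).
- by exists set0 => //; split=> z.
- move=> Q Q' [A BA [AS QA]] [A' BA' [AS' QA']]; exists (A `|` A'); first exact: BU.
  by split; [rewrite subUset|exact: setUSS].
- by move=> Q Q' QQ' [A BA [AS QA]]; exists A => //; split=> //; exact: subset_trans QA.
move=> x Sx; have [A BA [Ax AS]] := sepx _ Sx.
exists A; split=> //; first by have [] := Bclo _ BA.
by exists A => //; split=> // z.
Qed.

(** By compactness only points of [L], those without a neighbourhood of nowhere dense image, can
    obstruct. Near a value other than [f x], an isolated point [x] of [L] contributes nothing, and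
    the rest of its neighbourhood is harmless. *)
Lemma scattered_image_nowhere_dense (R : realType) (K : topologicalType)
    (f : K -> R) :
  compact [set: K] -> hausdorff_space K -> scattered K -> continuous f ->
  (closure (range f))° = set0.
Proof.
move=> cK hK sK cf.
pose nd (A : set K) := (closure (f @` A))° = set0.
have nd0 : nd set0 by rewrite /nd image_set0 closure0 interior0.
have ndU A B : nd A -> nd B -> nd (A `|` B).
  by rewrite /nd image_setU; exact: nowhere_denseU.
have ndS A B : A `<=` B -> nd B -> nd A.
  move=> AB ndB; apply/seteqP; split=> // y; rewrite -ndB.
  by apply: interiorS; apply: closureS; exact: image_subset.
have locnd C : compact C -> (forall x, C x -> exists V, [/\ open V, V x & nd V]) -> nd C.
  by move=> cC; exact: compact_ind.
apply: (locnd _ cK) => x0 _; apply: contrapT => nx0.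
(* An isolated point [x] of [L] has a closed neighbourhood whose image is
   somewhere dense although its part away from [f x] misses [L]. *)
pose L := [set x | ~ exists V, [/\ open V, V x & nd V]].
have [x [/set_mem Lx [V xV VL]]] := sK L (ex_intro _ x0 nx0).
have [W xW WV] := @compact_regular _ x _ hK cK (filterT) V xV.
apply: Lx; exists W°; split; [exact: open_interior|exact: xW|].
apply: (ndS _ (closure W)).
  by apply: subset_trans (@subset_closure _ W); exact: interior_subset.
apply: contrapT => /eqP/set0P[y0 Uy0].
set U := (closure _)° in Uy0.
have oU : open U by exact: open_interior.
have [y Uy yfx] : exists2 y, U y & y != f x.
  have /nbhs_ballP[e /= e0 eU] : nbhs y0 U by exact: open_nbhs_nbhs.
  have [y0x|] := eqVneq y0 (f x); last by exists y0.
  exists (y0 + e / 2); last by rewrite y0x -subr_eq0 addrC addKr gt_eqF// divr_gt0.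
  apply: eU; rewrite /ball /= opprD addNKr normrN gtr0_norm ?divr_gt0//.
  by rewrite gtr_pMr// invf_lt1// ltr1n.
have r0 : 0 < `|y - f x| / 2 by rewrite divr_gt0// normr_gt0 subr_eq0.
set r := `|y - f x| / 2 in r0.
(* Half the distance from [y] to [f x] as radius keeps [x] out of [C], so the compact set [C] misses
   [L]. *)
pose C := closure W `&` f @^-1` [set z | `|y - z| <= r].
have cC : compact C.
  apply: (subclosed_compact _ cK (subsetT _)); apply: closedI.
    exact: closed_closure.
  apply: closed_comp => [z _|]; first exact: cf.
  rewrite (_ : mkset _ = closed_ball_ Num.Def.normr y r)//.
  exact: closed_closed_ball_.
have ndC : nd C.
  apply: (locnd _ cC) => z [Wz /= zr]; apply: contrapT => Lz.
  have : (V `&` L) z by split=> //; exact: WV.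
  rewrite VL /= => zx; move: zr; rewrite zx /r.
  have yfx0 : 0 < `|y - f x| by rewrite normr_gt0 subr_eq0.
  by rewrite ler_pMr// leNgt invf_lt1// ltr1n.
suff : (closure (f @` C))° y by rewrite ndC.
rewrite /interior /= nbhsE; exists (U `&` ball y r).
  split; first by apply: openI => //; exact: ball_open.
  by split=> //; exact: ballxx.
move=> z [Uz yz].
have /(closureI_open _ _ _ (ball_open y r)) : (ball y r `&` closure (f @` closure W)) z.
  by split=> //; exact: interior_subset Uz.
apply: closureS => t [yt [w Ww wt]]; exists w => //; split=> //.
by move: yt; rewrite /ball /= wt => /ltW.
Qed.

(** Supplies the cuts [c] at which the set where [f < c] is clopen. *)
Lemma dense_rat_outside_image (R : realType) (K : topologicalType)
    (f : K -> R) (a b : R) :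
  (closure (range f))° = set0 -> a < b ->
  exists q : rat, a < ratr q < b /\ forall x, f x != ratr q.
Proof.
move=> f0 ab.
pose U := `]a, b[%classic `&` ~` closure (range f).
have oU : open U.
  apply: openI; first exact: interval_open.
  by apply: closed_openC; exact: closed_closure.
have U0 : U !=set0.
  apply: contrapT => nU; have : (closure (range f))° ((a + b) / 2).
    rewrite /interior /= nbhsE; exists `]a, b[%classic.
      by split; [exact: interval_open|rewrite /= in_itv /= !midf_lt].
    by move=> z abz; apply: contrapT => nz; apply: nU; exists z.
  by rewrite f0.
have [z [[abq nq] [q _ qE]]] := dense_rat U0 oU.
exists q; rewrite qE; split; first by move: abq; rewrite /= in_itv.
by move=> x; apply: contra_notN nq => /eqP <-; apply: subset_closure; exists x.
Qed.


(** * Continuous functions approximated through clopen sets *)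

Lemma omega1_basis (K : topologicalType) : has_weight K [set: omega1] ->
  exists b : omega1 -> set K, (forall i, open (b i)) /\
    forall x U, nbhs x U -> exists2 i, b i x & b i `<=` U.
Proof.
move=> [[B [Bo Bb] /card_eqPle[/pcard_surjP[g gB] _]] _].
(* The surjection [g] onto [B] may also take values outside [B]; these become [set0]. *)
exists (fun i => if `[< B (g i) >] then g i else set0); split.
  by move=> i; case: asboolP => [/Bo|_]; last exact: open0.
move=> x U /Bb[V [BV Vx] VU]; have [i _ gi] := gB _ BV.
by exists i; case: asboolP => //; rewrite gi.
Qed.

Section FunctionSpace.
Context {R : realType} {K : topologicalType}.
Implicit Types f g : Cp R K.

Lemma Cp_fun_continuous f : continuous (Cp_fun f).
Proof. exact: (@cts_fun _ _ (f : continuousType K R)). Qed.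

Lemma Cp_exists (h : K -> R) : continuous h -> exists f : Cp R K, Cp_fun f = h.
Proof. by move=> ch; exists (mkcts ch : continuousType K R). Qed.

Lemma uniform_metric_le f g (c : R) : 0 <= c ->
  (forall x, `|Cp_fun f x - Cp_fun g x| <= c) -> uniform_metric f g <= c.
Proof.
move=> c0 fgc; rewrite /uniform_metric; set A := (X in sup X).
(* For empty [K] the supremum is 0 by convention, and [0 <= c] gives the bound. *)
have [->|/set0P A0] := eqVneq A set0; first by rewrite sup0.
by apply: ge_sup => // _ [x _ <-].
Qed.

Lemma uniform_metric_Cp01 f g : Cp01 f -> Cp01 g -> f <> g ->
  1 <= uniform_metric f g.
Proof.
move=> f01 g01 fg.
have [x fgx] : exists x, Cp_fun f x <> Cp_fun g x.
  apply: contrapT => nfg; apply: fg; apply/continuousEP => x.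
  by apply: contrapT => ?; apply: nfg; exists x.
have d1 y : `|Cp_fun f y - Cp_fun g y| <= 1.
  by case: (f01 y) => ->; case: (g01 y) => ->;
    rewrite ?subrr ?subr0 ?sub0r ?normrN ?normr0 ?normr1.
apply: ub_le_sup; first by exists 1 => _ [y _ <-].
exists x => //; case: (f01 x) (g01 x) fgx => -> [] -> //.
  by rewrite sub0r normrN normr1.
by rewrite subr0 normr1.
Qed.

Lemma ltr_clopen f (c : R) : (forall x, Cp_fun f x != c) ->
  clopen [set x | Cp_fun f x < c].
Proof.
move=> fc; split.
  apply: (@open_comp _ _ (Cp_fun f) [set y | y < c]); last exact: open_lt.
  by move=> x _; exact: Cp_fun_continuous.
rewrite (_ : mkset _ = Cp_fun f @^-1` [set y | y <= c]).
  apply: closed_comp; last exact: closed_le.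
  by move=> x _; exact: Cp_fun_continuous.
by apply/seteqP; split=> x /=; rewrite le_eqVlt (negbTE (fc x)).
Qed.

Lemma clopen_Cp01 (S : set K) : clopen S ->
  exists2 f : Cp R K, @Cp01 R K f & S = [set x | Cp_fun f x = 1].
Proof.
move=> [oS cS].
have ch : continuous (fun x => (if `[< S x >] then 1 else 0) : R).
  move=> x; apply: cvg_near_cst; have [Sx|nSx] := pselect (S x).
    rewrite asboolT//; apply: filterS (open_nbhs_nbhs (conj oS Sx)) => y Sy.
    by rewrite asboolT.
  rewrite asboolF//.
  apply: filterS (open_nbhs_nbhs (conj (closed_openC cS) nSx)) => y nSy.
  by rewrite asboolF.
have [f fE] := Cp_exists _ ch; exists f.
  by move=> x; rewrite fE; case: ifP; [right|left].
apply/seteqP; split=> x; rewrite /= fE; first by move=> Sx; rewrite asboolT.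
by case: asboolP => // _ /esym/eqP; rewrite oner_eq0.
Qed.

Definition below f (c : rat) : set K := [set x | Cp_fun f x < ratr c].

(** A piece fixes finitely many cuts and, for each, the discrete family containing the clopen set
    below it. Near [f0], finitely many strict inequalities force these clopen sets to be those of
    [f0], so two functions there lie between the same close cuts at every point. *)
Lemma SLD_of_clopen_sigma_discrete (D : nat * nat -> set (set K)) :
  compact [set: K] -> hausdorff_space K -> scattered K ->
  (@clopen K) `<=` \bigcup_p D p ->
  (forall p S, D p S -> exists s : seq K, forall S', D p S' -> agree s S S' -> S' = S) ->
  SLD (@uniform_metric R K).
Proof.
move=> cK hK sK Dcov Ddisc e e0.
pose X (t : seq (rat * (nat * nat))) := [set f : Cp R K |
  [/\ forall p, p \in t -> D p.2 (below f p.1),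
      forall p, p \in t -> forall x, Cp_fun f x != ratr p.1 &
      forall x, exists p q, [/\ p \in t, q \in t,
        ratr p.1 < Cp_fun f x < ratr q.1 & ratr q.1 - ratr p.1 < e / 2]]].
have e20 : 0 < e / 2 by rewrite divr_gt0.
have e40 : 0 < e / 4 by rewrite divr_gt0.
have Xcov f : exists t, X t f.
  have f0 : (closure (range (Cp_fun f)))° = set0.
    by apply: scattered_image_nowhere_dense => //; exact: Cp_fun_continuous.
  pose P (Q : set K) := exists2 cs : seq rat,
    forall c, c \in cs -> forall x, Cp_fun f x != ratr c &
    forall x, Q x -> exists c d, [/\ c \in cs, d \in cs,
      ratr c < Cp_fun f x < ratr d & ratr d - ratr c < e / 2].
  have [cs cs1 cs2] : P setT.
    apply: compact_ind => //.
    - by exists [::].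
    - move=> A B [s s1 s2] [s' s1' s2']; exists (s ++ s').
        by move=> c; rewrite mem_cat => /orP[/s1|/s1'].
      move=> x [/s2|/s2'] [c [d [cs ds ? ?]]];
        by exists c, d; split=> //; rewrite mem_cat ?cs ?ds ?orbT.
    - by move=> A B AB [s s1 s2]; exists s => // x /AB/s2.
    move=> x _.
    (* Cuts within [e / 4] of the value on either side are less than [e / 2] apart. *)
    have [|c [/andP[ac cb] cf]] := dense_rat_outside_image _ _ _ (Cp_fun f x - e / 4) (Cp_fun f x) f0.
      by rewrite gtrBl.
    have [|d [/andP[ad db] df]] := dense_rat_outside_image _ _ _ (Cp_fun f x) (Cp_fun f x + e / 4) f0.
      by rewrite ltrDl.
    exists (Cp_fun f @^-1` `]ratr c, ratr d[%classic); split.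
    - apply: open_comp; last exact: interval_open.
      by move=> y _; exact: Cp_fun_continuous.
    - by rewrite /= in_itv /= cb ad.
    exists [:: c; d] => [c'|y /=]; first by rewrite !inE => /orP[]/eqP->.
    rewrite in_itv /= => cyd; exists c, d; split=> //; rewrite ?mem_head//.
      by rewrite !inE eqxx orbT.
    lra.
  have /choice[k kP] : forall c, exists k, (forall x, Cp_fun f x != ratr c) -> D k (below f c).
    move=> c; have [fc|nfc] := pselect (forall x, Cp_fun f x != ratr c).
      have [|k _ Dk] := Dcov (below f c); first exact: ltr_clopen.
      by exists k.
    by exists (0%N, 0%N).
  exists [seq (c, k c) | c <- cs]; split.
  - by move=> _ /mapP[c ccs ->] /=; apply: kP; exact: cs1.
  - by move=> _ /mapP[c ccs ->] /=; exact: cs1.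
  move=> x; have [c [d [ccs dcs fx cd]]] := cs2 x I.
  by exists (c, k c), (d, k d); split=> //; apply/mapP; [exists c|exists d].
exists (fun n => if unpickle n is Some t then X t else set0); split.
  apply/seteqP; split=> // f _; have [t Xt] := Xcov f.
  by exists (pickle t) => //; rewrite pickleK.
move=> n; case: unpickle => [t|]; last first.
  by exists set0; split=> //; apply/seteqP; split=> // f _; have := set_valP f.
exists [set V | open V /\
  (diam (sub_metric (@uniform_metric R K) (A := X t)) V < e%:E)%E].
split; [by move=> V []| |by move=> V []].
apply/seteqP; split=> // f _; have Xf : X t (set_val f) := set_valP f.
set f0 := set_val f in Xf.
have [Xf1 Xf2 Xf3] := Xf.
have /choice[s sP] : forall p, exists s, p \in t ->
    forall S, D p.2 S -> agree s (below f0 p.1) S -> S = below f0 p.1.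
  move=> p; have [pt|nt] := boolP (p \in t); last by exists [::].
  by have [s sP] := Ddisc _ _ (Xf1 _ pt); exists s.
(* An open half-line that keeps a value at [x] on the same side of [c] as that of [f0]. *)
pose side c x := if Cp_fun f0 x < c then [set y | y < c] else [set y : R | c < y].
pose W := [set g : Cp R K | forall p, p \in t -> forall x, x \in s p ->
  side (ratr p.1) x (Cp_fun g x)].
have oW : open W.
  apply: open_bigcap_seq => p _; apply: open_bigcap_seq => x _.
  apply: Cp_eval_open; rewrite /side; case: ifP => _; [exact: open_lt|exact: open_gt].
have WX g : X t g -> W g -> forall p, p \in t -> below g p.1 = below f0 p.1.
  move=> [Xg1 _ _] Wg p pt; apply: sP => //; first exact: Xg1.
  move=> x xs; have := Wg p pt x xs; rewrite /side /below /=.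
  by case: ifP => //= _ cg; split=> // gc; have := lt_trans cg gc; rewrite ltxx.
exists (set_val @^-1` W).
  split; first by exists W.
  rewrite diam_sub_metric; apply: (@le_lt_trans _ _ (e / 2)%:E).
    apply: ge_ereal_sup => _ [g [Yg Wg] [h [Yh Wh] <-]]; rewrite lee_fin.
    apply: uniform_metric_le => [|x]; first exact: ltW.
    have [_ Xh2 _] := Yh.
    have [_ _ /(_ x)[p [q [pt qt /andP[pg gq] pq]]]] := Yg.
    have hq : Cp_fun h x < ratr q.1.
      by rewrite -[is_true _]/(below h q.1 x) (WX h)// -(WX g).
    (* [h] avoids the cut, so not lying below it means lying strictly above it. *)
    have ph : ratr p.1 < Cp_fun h x.
      rewrite lt_neqAle eq_sym Xh2//= leNgt; apply/negP => hp.
      have : below h p.1 x by [].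
      by rewrite (WX h)// -(WX g)// /below /= ltNge (ltW pg).
    by rewrite ler_norml; lra.
  by rewrite lte_fin ltr_pdivrMr// ltr_pMr// ltr1n.
move=> p pt x xs; rewrite /side; case: ifPn => //=.
by rewrite -leNgt le_eqVlt eq_sym (negbTE (Xf2 _ pt x)).
Qed.
End FunctionSpace.


(** * Partitionings, clopen sets and the equivalence *)

(** A layer contains at most one point of [Z], so the first index [c g] is injective on the points
    of [X] in [Z], and on [V b] it takes only the countably many values up to [b]. *)
Lemma open_partitioning_locally_countable (R : realType) (T : topologicalType)
    (rho : T -> T -> R) (e : R) (X Z : set T) :
  (forall f g, Z f -> Z g -> f <> g -> e <= rho f g) ->
  has_open_partitioning omega1 (sub_metric rho (A := X)) e ->
  forall f, X f -> exists W, [/\ open W, W f & countable (X `&` Z `&` W)].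
Proof.
move=> Zdisc [U [Uo Umono Ucov Udiam]] f Xf.
have /choice[V VP] : forall b, exists V, open V /\ set_val @^-1` V = U b.
  by move=> b; have [[V oV VU] _] := Uo b; exists V.
have VX b g (Xg : X g) : V b g <-> U b (exist _ g (mem_set Xg)).
  by have [_ <-] := VP b.
have mono b b' g : (b <= b')%O -> X g -> V b g -> V b' g.
  by move=> bb Xg /(VX _ _ Xg)/(Umono _ _ bb)/(VX _ _ Xg).
have cover g : X g -> exists b, V b g.
  move=> Xg; have : (\bigcup_b U b) (exist _ g (mem_set Xg)) by rewrite Ucov.
  by move=> [b _ /(VX _ _ Xg) Vg]; exists b.
have /choice[c cP] : forall g, exists b, X g -> V b g /\ forall b', V b' g -> (b <= b')%O.
  move=> g; have [Xg|nX] := pselect (X g); last by have [b _] := omega1_nonempty; exists b.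
  by have [b Vb bmin] := omega1_min _ (cover _ Xg); exists b.
have cinj g h : X g -> X h -> Z g -> Z h -> c g = c h -> g = h.
  move=> Xg Xh Zg Zh cgh; apply: contrapT => gh.
  suff ed : (e%:E <= diam (sub_metric rho (A := X))
      (U (c g) `\` \bigcup_(b in [set b | (b < c g)%O]) U b))%E.
    by have := le_lt_trans ed (Udiam (c g)); rewrite ltxx.
  have layer k (Xk : X k) : (U (c k) `\` \bigcup_(b in [set b | (b < c k)%O]) U b)
      (exist _ k (mem_set Xk)).
    have [Vk kmin] := cP _ Xk; split; first exact/VX.
    by move=> [b /= bk /(VX _ _ Xk)/kmin]; rewrite leNgt bk.
  apply: (@le_trans _ _ (rho g h)%:E); first by rewrite lee_fin; exact: Zdisc.
  apply: ereal_sup_ubound; exists (exist _ g (mem_set Xg)); first exact: layer.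
  by exists (exist _ h (mem_set Xh)) => //; rewrite cgh; exact: layer.
have [b Vbf] := cover _ Xf.
exists (V b); split=> //; first by have [] := VP b.
have /countable_injP[k kinj] := countable_le_omega1 b.
apply/countable_injP; exists (k \o c) => g h; rewrite !inE.
move=> [[Xg Zg] Vg] [[Xh Zh] Vh] /= kc; apply: cinj => //.
by apply: kinj kc; rewrite inE /=; [have [_] := cP _ Xg|have [_] := cP _ Xh]; apply.
Qed.

(** A clopen set, being compact, is a finite union of basic sets; stage [a] collects those written
    with indices up to [a]. *)
Lemma clopen_omega1_filtration (K : topologicalType) (b : omega1 -> set K) :
  compact [set: K] -> (forall i, open (b i)) ->
  (forall x U, nbhs x U -> exists2 i, b i x & b i `<=` U) ->
  exists A : omega1 -> set (set K),
    [/\ forall a, countable (A a),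
        forall a a', (a <= a')%O -> A a `<=` A a' &
        @clopen K = \bigcup_a A a].
Proof.
move=> cK ob bK.
pose u (s : seq omega1) := \bigcup_(i in [set` s]) b i.
exists (fun a => [set S | clopen S /\
  exists2 s, forall i, i \in s -> (i <= a)%O & S = u s]); split.
- move=> a; have := countable_seq _ _ (countable_le_omega1 a); apply: sub_countable.
  apply: card_le_trans (card_image_le u _).
  by apply: subset_card_le => S [_ [s sa ->]]; exists s.
- move=> a a' aa' S [cS [s sa SE]]; split=> //.
  by exists s => // i /sa ia; exact: le_trans aa'.
apply/seteqP; split=> S; last by move=> [a _ [cS _]].
move=> cS.
have [w0 _] := omega1_nonempty.
have ubound (s : seq omega1) : exists a, forall i, i \in s -> (i <= a)%O.
  elim: s => [|i s [a sa]]; first by exists w0.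
  exists (Order.max i a) => j; rewrite inE le_max => /predU1P[->|/sa->].
    by rewrite lexx.
  by rewrite orbT.
suff [s sS] : exists s, u s = S.
  by have [a sa] := ubound s; exists a => //; split=> //; exists s.
have [oS clS] := cS.
suff [s sS Ss] : exists2 s, u s `<=` S & S `<=` u s by exists s; apply/seteqP.
apply: (@compact_ind _ _ (fun Q => exists2 s, u s `<=` S & Q `<=` u s)).
- exact: (subclosed_compact clS cK (subsetT _)).
- by exists [::] => // x [].
- move=> Q Q' [s sS Qs] [s' sS' Qs']; exists (s ++ s').
    move=> x [i /=]; rewrite mem_cat => /orP[is_|is_] bx.
      by apply: sS; exists i.
    by apply: sS'; exists i.
  move=> x [/Qs|/Qs'] [i /= is_ bx]; exists i => //=;
    by rewrite mem_cat is_ ?orbT.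
- by move=> Q Q' QQ' [s sS Qs]; exists s => // x /QQ'/Qs.
move=> x Sx; have [i bx bS] := bK x S (open_nbhs_nbhs (conj oS Sx)).
exists (b i); split=> //; exists [:: i] => y.
  by move=> [j /=]; rewrite inE => /eqP-> /bS.
by move=> by_; exists i => //=; rewrite mem_head.
Qed.

(** [r t] bounds the indices in [t], and countably many finite lists use only indices below a given
    bound. *)
Lemma Cp_omega1_network (R : realType) (K : topologicalType)
    (b : omega1 -> set K) :
  (forall x U, nbhs x U -> exists2 i, b i x & b i `<=` U) ->
  exists (N : seq (omega1 * (rat * rat)) -> set (Cp R K))
         (r : seq (omega1 * (rat * rat)) -> omega1),
    (forall a, countable [set t | r t = a]) /\
    forall f W, open W -> W f -> exists2 t, N t f & N t `<=` W.
Proof.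
move=> bK; have [w0 _] := omega1_nonempty.
pose N (t : seq (omega1 * (rat * rat))) := [set f : Cp R K |
  forall p, p \in t -> forall x, b p.1 x -> ratr p.2.1 < Cp_fun f x < ratr p.2.2].
pose r (t : seq (omega1 * (rat * rat))) := foldr (fun p a => Order.max p.1 a) w0 t.
exists N, r; split.
  move=> a; have := countableX (countable_le_omega1 a) (countableP [set: rat * rat]).
  move=> /countable_seq; apply: sub_countable; apply: subset_card_le => t /= <- p.
  elim: t => //= q t IH; rewrite inE => /predU1P[->|/IH[/= pt _]]; split=> //=.
    by rewrite le_max lexx.
  by rewrite le_max pt orbT.
move=> f W oW Wf; have [s [d d0 sW]] := Cp_open_nbhs _ _ _ _ oW Wf.
(* Rational bounds within [d / 2] of the value at [x] confine both [f] and any [g] in [N] to an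
   interval shorter than [d]. *)
have /choice[p pP] : forall x, exists p : omega1 * (rat * rat), [/\ b p.1 x,
    forall y, b p.1 y -> ratr p.2.1 < Cp_fun f y < ratr p.2.2 &
    ratr p.2.2 - ratr p.2.1 < d :> R].
  move=> x; have d20 : 0 < d / 2 by rewrite divr_gt0.
  have [|c] := @rat_in_itvoo R (Cp_fun f x - d / 2) (Cp_fun f x); first by rewrite gtrBl.
  have [|c'] := @rat_in_itvoo R (Cp_fun f x) (Cp_fun f x + d / 2); first by rewrite ltrDl.
  rewrite !in_itv /= => /andP[c'1 c'2] /andP[c1 c2].
  have [|i bx bi] := bK x (Cp_fun f @^-1` `]ratr c, ratr c'[%classic).
    apply: open_nbhs_nbhs; split; last by rewrite /= in_itv /= c2.
    apply: open_comp; last exact: interval_open.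
    by move=> y _; exact: Cp_fun_continuous.
  exists (i, (c, c')); split=> //=; last by lra.
exists (map p s).
  by move=> _ /mapP[x _ ->] y by_; have [_ + _] := pP x; apply.
move=> g Ng; apply: sW => x xs; have [bx fp pd] := pP x.
have := Ng _ (map_f p xs) _ bx; have := fp _ bx.
by move=> /andP[? ?] /andP[? ?]; rewrite ltr_norml; lra.
Qed.

Lemma clopen_sigma_discrete_of_partitionings (R : realType)
    (K : topologicalType) (b : omega1 -> set K) (Xs : nat -> set (Cp R K)) :
  compact [set: K] -> (forall i, open (b i)) ->
  (forall x U, nbhs x U -> exists2 i, b i x & b i `<=` U) ->
  @Cp01 R K `<=` \bigcup_n Xs n ->
  (forall n, has_open_partitioning omega1
     (sub_metric (@uniform_metric R K) (A := Xs n)) 1) ->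
  exists D : nat * nat -> set (set K),
    @clopen K = \bigcup_p D p /\
    forall p S, D p S -> exists s : seq K, forall S', D p S' -> agree s S S' -> S' = S.
Proof.
move=> cK ob bK Xcov Xpart.
have [A [Ac Amono AE]] := clopen_omega1_filtration _ _ cK ob bK.
pose X n := [set S | clopen S /\ exists f, [/\ Xs n f, Cp01 f & S = [set x | Cp_fun f x = 1]]].
have Xc n S : exists s : seq K, X n S -> countable [set S' | X n S' /\ agree s S S'].
  have [[cS [f [Xf f01 SE]]]|nX] := pselect (X n S); last by exists [::].
  have [W [oW Wf Wc]] := open_partitioning_locally_countable _ _ _ _ _ (@Cp01 R K)
    (@uniform_metric_Cp01 R K) (Xpart n) _ Xf.
  have [s [d d0 sW]] := Cp_open_nbhs _ _ _ _ oW Wf.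
  exists s => _; apply: sub_countable Wc.
  apply: card_le_trans (card_image_le (fun g => [set x | Cp_fun g x = 1]) _).
  apply: subset_card_le => S' [[_ [g [Xg g01 SE']]] agr]; exists g => //.
  (* Functions with values 0 and 1 whose clopen sets agree on [s] coincide on [s]. *)
  split=> //; apply: sW => x xs; suff -> : Cp_fun f x = Cp_fun g x.
    by rewrite subrr normr0.
  have := agr _ xs; rewrite SE SE' /= => fg.
  case: (f01 x) fg => -> ; case: (g01 x) => -> // fg.
    by have /eqP := fg.2 erefl; rewrite eq_sym oner_eq0.
  by have /eqP := fg.1 erefl; rewrite eq_sym oner_eq0.
have /choice[w wP] : forall p : nat * set K, exists s : seq K,
    X p.1 p.2 -> countable [set S' | X p.1 S' /\ agree s p.2 S'].
  by move=> [n S]; exact: Xc.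
apply: (locally_countable_sigma_discrete _ _ A X (fun n S => w (n, S))) => //.
- by move=> S; exact: clopenC.
- by move=> S S'; exact: clopenI.
- by move=> B BCO BC BI S cS nBS; exact: subalgebra_pointwise_closed.
- apply/seteqP; split=> S; last by move=> [n _ [cS _]].
  move=> cS.
  have [f f01 SE] := clopen_Cp01 (R := R) _ cS.
  by have [n _ Xf] := Xcov _ f01; exists n => //; split=> //; exists f.
by move=> n S XS; exact: (wP (n, S)).
Qed.

Theorem corollary3p11 (R : realType) (K : topologicalType)
  (hcompact : compact [set: K]) (hhausdorff : hausdorff_space K)
  (hscattered : scattered K) (hweight : has_weight K [set: omega1]) :
  SLD (@uniform_metric R K) <->
  (forall e : R, 0 < e ->
   exists Xs : nat -> set (Cp R K),
     @Cp01 R K `<=` \bigcup_n Xs n /\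
     forall n, has_open_partitioning omega1
       (sub_metric (@uniform_metric R K) (A := Xs n)) e).
Proof.
have [b [ob bK]] := omega1_basis K hweight.
split=> [sld e e0|part].
  have [N [r [rc Nnet]]] := Cp_omega1_network R K b bK.
  (* The zero function is the base point filling empty pieces. *)
  have [z _] := Cp_exists (R := R) (cst 0) (@cst_continuous K R 0).
  have z0 : uniform_metric z z <= 0.
    by apply: uniform_metric_le => // x; rewrite subrr normr0.
  have [Xs [Xcov Xpart]] := SLD_open_partitionings _ _ _ z _ N r z0 rc Nnet sld e e0.
  by exists Xs; split=> // f _; rewrite Xcov.
(* At [e = 1] a layer contains at most one function with values 0 and 1. *)
have [Xs [Xcov Xpart]] := part 1 ltr01.
have [D [DE Ddisc]] := clopen_sigma_discrete_of_partitionings R K b Xs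
  hcompact ob bK Xcov Xpart.
by apply: (SLD_of_clopen_sigma_discrete D) => //; rewrite DE.
Qed.
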